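(* Let $\mathfrak g=(\mathfrak g_0\oplus\mathfrak g_{-1},d,[\cdot,\cdot],l_3)$ be a Lie $2$-algebra. The Lie algebra of the Lie group $(\mathrm{Aut}^{-1}(\mathfrak g),\star)$ is $(\mathrm{Der}^{-1}(\mathfrak g),\{\cdot,\cdot\})$, where $\mathrm{Aut}^{-1}(\mathfrak g)$ is the group of units of the monoid $\mathrm{Hom}(\mathfrak g_0,\mathfrak g_{-1})$ with product $$\tau\star\tau'=\tau+\tau'+\tau\circ d\circ\tau',$$ and $\mathrm{Der}^{-1}(\mathfrak g)=\mathrm{Hom}(\mathfrak g_0,\mathfrak g_{-1})$ with bracket $$\{\Theta,\Theta'\}=\Theta\circ d\circ\Theta'-\Theta'\circ d\circ\Theta.$$ Additionally, the exponential map $e:\mathrm{Der}^{-1}(\mathfrak g)\to\mathrm{Aut}^{-1}(\mathfrak g)$ is given by $$e^{\Theta}=\Theta+\frac{\Theta\circ d\circ\Theta}{2!}+\frac{\Theta\circ d\circ\Theta\circ d\circ\Theta}{3!}+\cdots=\sum_{n=1}^\infty\frac{(\Theta\circ d)^{n-1}\circ\Theta}{n!}.$$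
   Context: All vector spaces are real and finite-dimensional. A Lie $2$-algebra $\mathfrak g=(\mathfrak g_0\oplus\mathfrak g_{-1},d,[\cdot,\cdot],l_3)$ consists of vector spaces $\mathfrak g_0,\mathfrak g_{-1}$, a linear map $d:\mathfrak g_{-1}\to\mathfrak g_0$, a skew-symmetric bracket $[\cdot,\cdot]$ and a skew-symmetric trilinear map $l_3:\wedge^3\mathfrak g_0\to\mathfrak g_{-1}$ satisfying the axioms of a $2$-term $L_\infty$-algebra; only the linear map $d:\mathfrak g_{-1}\to\mathfrak g_0$ enters the present statement. The identity element of the monoid $(\mathrm{Hom}(\mathfrak g_0,\mathfrak g_{-1}),\star)$ is the zero map. $\mathrm{Aut}^{-1}(\mathfrak g)$ carries the smooth structure inherited from the vector space $\mathrm{Hom}(\mathfrak g_0,\mathfrak g_{-1})$, and its tangent space at the identity $0$ is identified with a subspace of $\mathrm{Hom}(\mathfrak g_0,\mathfrak g_{-1})$. *)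

(* Defs.v *)
From HB Require Import structures.
From mathcomp Require Import all_boot all_order all_algebra.
From mathcomp Require Import all_classical all_reals all_analysis.

Set Implicit Arguments.
Unset Strict Implicit.
Unset Printing Implicit Defensive.

Import Order.TTheory GRing.Theory Num.Theory.
Import numFieldNormedType.Exports.

Local Open Scope classical_set_scope.
Local Open Scope ring_scope.

(* The space of linear maps between finite-dimensional spaces is normed by    *)
(* the max norm of the matrix in the coordinates provided by vectType. All    *)
(* norms on it are equivalent, so the resulting topology and notion of        *)
(* differentiability are the standard ones of a finite-dimensional space.     *)
Section HomNorm.
Import VectorInternalTheory.
Context (R : realType) (aT rT : vectType R).
Implicit Types f g : 'Hom(aT, rT).

Definition lfun_norm f : R := `|f2mx f|.

Let f2mxD f g : f2mx (f + g) = f2mx f + f2mx g.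
Proof.
suff -> : f + g = Hom (f2mx f + f2mx g) by [].
by apply/lfunP => v; rewrite add_lfunE unlock /= mulmxDr linearD.
Qed.

Let f2mxZ (k : R) f : f2mx (k *: f) = k *: f2mx f.
Proof.
suff -> : k *: f = Hom (k *: f2mx f) by [].
by apply/lfunP => v; rewrite scale_lfunE unlock /= -scalemxAr linearZ.
Qed.

Let lfun_normD f g : lfun_norm (f + g) <= lfun_norm f + lfun_norm g.
Proof. by rewrite /lfun_norm f2mxD ler_normD. Qed.

Let lfun_normZ (k : R) f : lfun_norm (k *: f) = `|k| * lfun_norm f.
Proof. by rewrite /lfun_norm f2mxZ normrZ. Qed.

Let lfun_norm0_eq0 f : lfun_norm f = 0 -> f = 0.
Proof.
move=> /eqP; rewrite /lfun_norm normr_eq0 => /eqP f0.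
by apply/lfunP => v; rewrite zero_lfunE unlock /= f0 mulmx0 linear0.
Qed.

HB.instance Definition _ := @Lmodule_isNormed.Build R 'Hom(aT, rT)
  lfun_norm lfun_normD lfun_normZ lfun_norm0_eq0.
End HomNorm.

Section Smooth.
Context {R : realType}.

(* On an open set U of a finite-dimensional space, f is C^(k+1) iff it is     *)
(* differentiable and all its directional derivatives are C^k.                *)
Fixpoint Ck_on (V W : normedModType R) (k : nat) (U : set V) (f : V -> W)
    : Prop :=
  if k is k'.+1 then
    (forall x, U x -> differentiable f x) /\
    (forall v : V, Ck_on k' U (fun x => 'd f x v))
  else forall x, U x -> {for x, continuous f}.

Definition smooth_on (V W : normedModType R) (U : set V) (f : V -> W) : Prop :=
  forall k, Ck_on k U f.

End Smooth.

(* Lie groups whose underlying manifold is an open subset G of a normed space *)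
(* V with its canonical global chart: smoothness is smoothness of maps        *)
(* between (products of) open subsets of V. The multiplication is given as a  *)
(* total function on V, of which only the values on G `*` G matter.           *)
Section OpenLieGroup.
Context {R : realType} {V : normedModType R}.
Variables (G : set V) (mul : V -> V -> V) (one : V).

Definition is_lie_group : Prop :=
  [/\ open G,
      G one,
      (forall x y, G x -> G y -> G (mul x y)) /\
      (forall x y z, G x -> G y -> G z -> mul x (mul y z) = mul (mul x y) z),
      (forall x, G x -> mul one x = x /\ mul x one = x) /\
      smooth_on (G `*` G) (fun p : V * V => mul p.1 p.2) &
      exists inv : V -> V, smooth_on G inv /\
        forall x, G x -> [/\ G (inv x), mul (inv x) x = one
                                      & mul x (inv x) = one]].

Definition tangent_space (x : V) : set V :=
  [set v | exists (gamma : R -> V) (I : set R),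
    [/\ open I /\ I 0, smooth_on I gamma, (forall t, I t -> G (gamma t)),
        gamma 0 = x & is_derive (0 : R) (1 : R) gamma v]].

Definition left_invariant_field (X : V) : V -> V :=
  fun g => 'd (mul g) one X.

(* [X, Y] = X(Y) - Y(X) as derivations, i.e. DY.X - DX.Y in the global chart. *)
Definition vector_field_bracket (X Y : V -> V) : V -> V :=
  fun g => 'd Y g (X g) - 'd X g (Y g).

Definition lie_group_bracket (X Y : V) : V :=
  vector_field_bracket (left_invariant_field X) (left_invariant_field Y) one.

Definition is_lie_algebra_of (h : set V) (br : V -> V -> V) : Prop :=
  tangent_space one = h /\
  forall X Y, h X -> h Y -> lie_group_bracket X Y = br X Y.

Definition one_parameter_subgroup (X : V) (gamma : R -> V) : Prop :=
  [/\ smooth_on setT gamma,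
      (forall t, G (gamma t)),
      (forall s t, gamma (s + t) = mul (gamma s) (gamma t)) &
      is_derive (0 : R) (1 : R) gamma X].

Definition lie_exp (X : V) : V :=
  (get [set gamma | one_parameter_subgroup X gamma]) 1.

End OpenLieGroup.

(* 2-term L_infinity-algebras. The bracket has components g0 x g0 -> g0       *)
(* (lie2_br) and g0 x gm1 -> gm1 (lie2_act); skew-symmetry forces             *)
(* [a, x] = - [x, a] for a in gm1, and [gm1, gm1] = 0 for degree reasons.     *)
(* Multilinear maps are curried.                                              *)
Record lie2_algebra (R : realType) := Lie2Algebra {
  lie2_0 : vectType R;
  lie2_m1 : vectType R;
  lie2_d : 'Hom(lie2_m1, lie2_0);
  lie2_br : 'Hom(lie2_0, 'Hom(lie2_0, lie2_0));
  lie2_act : 'Hom(lie2_0, 'Hom(lie2_m1, lie2_m1));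
  lie2_l3 : 'Hom(lie2_0, 'Hom(lie2_0, 'Hom(lie2_0, lie2_m1)));
  lie2_br_skew : forall x y, lie2_br x y = - lie2_br y x;
  lie2_l3_skew12 : forall x y z, lie2_l3 x y z = - lie2_l3 y x z;
  lie2_l3_skew23 : forall x y z, lie2_l3 x y z = - lie2_l3 x z y;
  (* d [x, a] = [x, d a] *)
  lie2_d_act : forall x a, lie2_d (lie2_act x a) = lie2_br x (lie2_d a);
  (* [d a, b] = [a, d b] *)
  lie2_act_d : forall a b, lie2_act (lie2_d a) b = - lie2_act (lie2_d b) a;
  (* [x, [y, z]] + c.p. = d l3(x, y, z) *)
  lie2_jacobi : forall x y z,
    lie2_br x (lie2_br y z) + lie2_br y (lie2_br z x) + lie2_br z (lie2_br x y)
    = lie2_d (lie2_l3 x y z);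
  (* [x, [y, a]] + [y, [a, x]] + [a, [x, y]] = l3(x, y, d a) *)
  lie2_jacobi_act : forall x y a,
    lie2_act x (lie2_act y a) - lie2_act y (lie2_act x a)
      - lie2_act (lie2_br x y) a
    = lie2_l3 x y (lie2_d a);
  lie2_coherence : forall x y z w,
    lie2_act x (lie2_l3 y z w) - lie2_act y (lie2_l3 x z w)
      + lie2_act z (lie2_l3 x y w) - lie2_act w (lie2_l3 x y z)
    = lie2_l3 (lie2_br x y) z w - lie2_l3 (lie2_br x z) y w
      + lie2_l3 (lie2_br x w) y z + lie2_l3 (lie2_br y z) x w
      - lie2_l3 (lie2_br y w) x z + lie2_l3 (lie2_br z w) x y }.

Notation hom_m1 g := 'Hom(lie2_0 g, lie2_m1 g).

Section DegreeMinusOne.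
Context {R : realType} (g : lie2_algebra R).

Definition comp_d (s t : hom_m1 g) : hom_m1 g := (s \o (lie2_d g \o t))%VF.

Definition star (s t : hom_m1 g) : hom_m1 g := s + t + comp_d s t.

Definition Aut_m1 : set (hom_m1 g) :=
  [set s | exists t, star s t = 0 /\ star t s = 0].

Definition Der_m1 : set (hom_m1 g) := setT.

Definition Der_m1_bracket (s t : hom_m1 g) : hom_m1 g := comp_d s t - comp_d t s.

(* (s \o d)^k \o s *)
Definition comp_d_pow (s : hom_m1 g) (k : nat) : hom_m1 g := iter k (comp_d s) s.

End DegreeMinusOne.

Arguments star {R} g s t.
Arguments Aut_m1 {R} g.
Arguments Der_m1 {R} g.
Arguments Der_m1_bracket {R} g s t.
Arguments comp_d_pow {R g} s k.

(* Main.v *)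
From HB Require Import structures.
Require Import Defs.
From mathcomp Require Import all_boot all_order all_algebra.
From mathcomp Require Import all_classical all_reals all_analysis.
From mathcomp Require Import ring lra.
Import Order.TTheory GRing.Theory Num.Theory.
Import numFieldNormedType.Exports.
Local Open Scope classical_set_scope.
Local Open Scope ring_scope.

(* Put B(s, t) = s d t, an associative bilinear map, so that the product is
   the circle operation x + y + B(x, y). For z small, t |-> t + B(z, t) is
   injective, hence surjective in finite dimension, so z is a unit; translating,
   the units form an open set. The inverse w of z satisfies w + z = - B(z, w),
   so inversion has differential - id at 0, and by translation its differential
   at x is a polynomial in the inverse of x: smoothness follows by induction on
   the order of differentiability. The left-invariant field of X is
   h |-> X + B(h, X), which gives the bracket.
   The exponential series E solves both E' = X + B(E, X) and E' = X + B(X, E).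
   If f solves the first equation and g the second, f(t) * g(- t) is constant;
   this yields both E(s + t) = E(s) * E(t) and the uniqueness of the
   one-parameter subgroup with initial velocity X. *)

(** * Differentials: epsilon estimates, locality, the bilinear product rule *)

Section DifferentialCalculus.
Context {R : realType}.
Implicit Types V W : normedModType R.

(** Epsilon form of differentiability, which lets inversion at 0 be handled by explicit norm
    estimates. *)
Lemma is_diff_linear_approx {V W} (f : V -> W) (df : {linear V -> W}) (x : V) :
  continuous df ->
  (forall eps : R, 0 < eps ->
     \forall h \near 0, `|f (h + x) - f x - df h| <= eps * `|h|) ->
  is_diff x f df.
Proof.
move=> dfc H.
have E : f \o shift x = cst (f x) + df +o_ 0 id.
  apply/eqaddoP => eps eps0; near=> h.
  have -> : (f \o shift x - (cst (f x) + df)) h = f (h + x) - f x - df h.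
    by rewrite opprD addrA.
  by near: h; exact: H.
have dE : 'd f x = df :> (V -> W) by exact: diff_unique.
by apply: DiffDef => //; apply/diff_locallyP; rewrite dE.
Unshelve. all: by end_near. Qed.

Lemma is_diff_approx {V W} (f df : V -> W) (x : V) : is_diff x f df ->
  forall eps : R, 0 < eps ->
     \forall h \near 0, `|f (h + x) - f x - df h| <= eps * `|h|.
Proof.
move=> [fx <-] eps eps0; have /diff_locally /eqaddoP /(_ eps eps0) := fx.
apply: filterS => h; congr (`|_| <= _).
by rewrite -[LHS]/(f (h + x) - (f x + 'd f x h)) opprD addrA.
Qed.

Lemma near_eq_is_diff {V W} (f g df : V -> W) (x : V) :
  {near x, f =1 g} -> is_diff x f df -> is_diff x g df.
Proof.
move=> fg dfx; rewrite -(@diff_val _ _ _ _ _ _ _ dfx).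
apply: is_diff_linear_approx; first exact: diff_continuous.
move=> eps eps0; have fgx := nbhs_singleton fg.
have fg0 : \forall h \near 0, f (h + x) = g (h + x).
  by have := fg; rewrite (near_shift 0) subr0.
near=> h; rewrite -fgx -(near fg0 h)// diff_val.
by near: h; exact: is_diff_approx.
Unshelve. all: by end_near. Qed.

Lemma is_diff_bilinear {V W1 W2 W : normedModType R}
    (B : {bilinear W1 -> W2 -> W}) (f df : V -> W1) (g dg : V -> W2) (x : V) :
  continuous (fun p => B p.1 p.2) -> is_diff x f df -> is_diff x g dg ->
  is_diff x (fun y => B (f y) (g y)) (fun v => B (f x) (dg v) + B (df v) (g x)).
Proof.
move=> Bc dfx dgx; pose b := fun p : W1 * W2 => B p.1 p.2.
have db : is_diff (f x, g x) b (fun q => B (f x) q.2 + B q.1 (g x)).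
  apply: DiffDef; first exact: (differentiable_bilin _ Bc).
  exact: (@diff_bilin _ _ _ _ _ (f x, g x) Bc).
exact: (@is_diff_comp _ _ _ _ (fun y => (f y, g y)) _ b).
Qed.

Lemma is_diff_is_derive {W} (f : R -> W) (df : R -> W) (t : R) :
  is_diff t f df -> is_derive t (1 : R) f (df 1).
Proof.
move=> dft; apply: DeriveDef; first exact: diff_derivable.
by rewrite deriveE ?diff_val.
Qed.

Lemma is_derive_is_diff {W} (f : R -> W) (l : W) (t : R) :
  is_derive t (1 : R) f l -> is_diff t f ( *:%R ^~ l).
Proof.
move=> dft; apply: DiffDef; first exact/derivable1_diffP.
by rewrite deriv1E// derive1E derive_val.
Qed.

Lemma linear_contraction_continuous {V W}
    (f : {linear V -> W}) : (forall x, `|f x| <= `|x|) -> continuous f.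
Proof.
move=> fle x; apply/cvgrPdist_lt => eps eps0; near=> y.
by rewrite -linearB (le_lt_trans (fle _)).
Unshelve. all: by end_near. Qed.

End DifferentialCalculus.

(** * Closure properties of maps of class C^k on an open set *)

Section SmoothCalculus.
Context {R : realType}.
Implicit Types V W : normedModType R.

(** Since [U] is open, maps that agree on it agree near each of its points, hence have the same
    differentials there. *)
Lemma eq_Ck_on k {V W} (U : set V) (f g : V -> W) : open U ->
  (forall x, U x -> f x = g x) -> Ck_on k U f -> Ck_on k U g.
Proof.
move=> oU; elim: k f g => [|k IH] f g fg.
  move=> fc x Ux; have fgx : {near x, f =1 g}.
    by near=> y; apply: fg; near: y; exact: open_nbhs_nbhs.
  rewrite /prop_for /continuous_at -(fg x Ux).
  by apply: cvg_trans (fc x Ux); exact: near_eq_cvg.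
move=> [fd df].
have gf x : U x -> is_diff x g ('d f x).
  move=> Ux; apply: (@near_eq_is_diff _ _ _ f); last exact/differentiableP/fd.
  by near=> y; apply: fg; near: y; exact: open_nbhs_nbhs.
split=> [x Ux|v]; first by have := gf x Ux => -[].
by apply: IH (df v) => x Ux; rewrite (@diff_val _ _ _ _ _ _ _ (gf x Ux)).
Unshelve. all: by end_near. Qed.

(** Allows an explicit formula, valid on [U] only, in place of ['d f x]; this drives the inductions
    on the order below. *)
Lemma Ck_onS k {V W} (U : set V) (f : V -> W) (df : V -> V -> W) : open U ->
  (forall x, U x -> is_diff x f (df x)) -> (forall v, Ck_on k U (df ^~ v)) ->
  Ck_on k.+1 U f.
Proof.
move=> oU fd dfk; split=> [x Ux|v]; first by have := fd x Ux => -[].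
by apply: eq_Ck_on (dfk v) => // x Ux; rewrite (@diff_val _ _ _ _ _ _ _ (fd x Ux)).
Qed.

Lemma Ck_onW k {V W} (U : set V) (f : V -> W) : Ck_on k.+1 U f -> Ck_on k U f.
Proof.
elim: k f => [|k IH] f [fd df].
  by move=> x Ux; exact/differentiable_continuous/fd.
by split=> // v; exact/IH/df.
Qed.

Lemma Ck_on_cst k {V W} (U : set V) (a : W) : open U -> Ck_on k U (fun=> a).
Proof.
move=> oU; elim: k a => [|k IH] a; first by move=> x _; exact: cst_continuous.
by apply: (Ck_onS _ _ _ (fun=> 0)) => // x _; exact: is_diff_cst.
Qed.

Lemma Ck_on_linear k {V W} (U : set V) (f : {linear V -> W}) : open U ->
  continuous f -> Ck_on k U f.
Proof.
move=> oU fc; case: k => [|k]; first by move=> x _; exact: fc.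
apply: (Ck_onS _ _ _ (fun=> f)) => // [x _|v]; last exact: Ck_on_cst.
by apply: DiffDef; [exact: linear_differentiable|rewrite diff_lin].
Qed.

Lemma Ck_onD k {V W} (U : set V) (f g : V -> W) : open U ->
  Ck_on k U f -> Ck_on k U g -> Ck_on k U (fun x => f x + g x).
Proof.
move=> oU; elim: k f g => [|k IH] f g fk gk.
  by move=> x Ux; apply: continuousD; [exact: fk|exact: gk].
have [fd dfk] := fk; have [gd dgk] := gk.
apply: (Ck_onS _ _ _ (fun x v => 'd f x v + 'd g x v)) => // [x Ux|v].
  by apply: is_diffD; apply: differentiableP; [exact: fd|exact: gd].
by apply: IH; [exact: dfk|exact: dgk].
Qed.

(** By the Leibniz rule the differential is a sum of two terms of the same shape, each pairing one
    map with a derivative of the other, so the induction must range over both maps. *)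
Lemma Ck_on_bilinear k {V W1 W2 W : normedModType R} (U : set V)
    (B : {bilinear W1 -> W2 -> W}) (f : V -> W1) (g : V -> W2) :
  open U -> continuous (fun p => B p.1 p.2) ->
  Ck_on k U f -> Ck_on k U g -> Ck_on k U (fun x => B (f x) (g x)).
Proof.
move=> oU Bc; elim: k f g => [|k IH] f g fk gk.
  move=> x Ux; apply: (@continuous_comp _ _ _ (fun x => (f x, g x))
    (fun p => B p.1 p.2)) => //; last exact: Bc.
  by apply: cvg_pair; [exact: fk|exact: gk].
have [fk' gk'] := (Ck_onW _ _ _ fk, Ck_onW _ _ _ gk).
have [fd dfk] := fk; have [gd dgk] := gk.
apply: (Ck_onS _ _ _ (fun x v => B (f x) ('d g x v) + B ('d f x v) (g x)))
    => // [x Ux|v].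
  by apply: is_diff_bilinear => //; apply: differentiableP; [exact: fd|exact: gd].
by apply: Ck_onD => //; apply: IH => //; [exact: dgk|exact: dfk].
Qed.

End SmoothCalculus.

(** * The circle monoid of an associative continuous bilinear map *)

Section CircleMonoid.
Context {R : realType} {V : normedModType R} (B : {bilinear V -> V -> V}).
Context (B_continuous : continuous (fun p : V * V => B p.1 p.2)).
Context (BA : forall x y z, B x (B y z) = B (B x y) z).
Implicit Types x y z : V.

(** With a formal unit 1 adjoined to the algebra, this is (1 + x)(1 + y) - 1. *)
Definition circle x y : V := x + y + B x y.

Definition circle_units : set V :=
  [set x | exists y, circle x y = 0 /\ circle y x = 0].

(** Made total by choice; its value is meaningful on [circle_units] only. *)
Definition circle_inv x : V :=
  get [set y | circle x y = 0 /\ circle y x = 0].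

Lemma circle0x x : circle 0 x = x.
Proof. by rewrite /circle linear0l add0r addr0. Qed.

Lemma circlex0 x : circle x 0 = x.
Proof. by rewrite /circle linear0r !addr0. Qed.

Lemma circleA x y z : circle x (circle y z) = circle (circle x y) z.
Proof.
rewrite /circle !linearDr !linearDl BA /=.
rewrite -!addrA; do 2!congr (_ + _).
by rewrite (addrCA (B y z)) (addrCA z) (addrCA (B y z)).
Qed.

Lemma circle_units0 : circle_units 0.
Proof. by exists 0; rewrite circle0x. Qed.

Lemma circle_unitsM x y : circle_units x -> circle_units y -> circle_units (circle x y).
Proof.
move=> [x' [xx' x'x]] [y' [yy' y'y]]; exists (circle y' x'); split.
  by rewrite -circleA (circleA y) yy' circle0x.
by rewrite -circleA (circleA x') x'x circle0x.
Qed.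

Lemma circle_invP x : circle_units x ->
  circle x (circle_inv x) = 0 /\ circle (circle_inv x) x = 0.
Proof.
move=> [y xy].
exact: (@getPex _ [set y | circle x y = 0 /\ circle y x = 0] (ex_intro _ y xy)).
Qed.

Lemma circle_inv_unit x : circle_units x -> circle_units (circle_inv x).
Proof. by move=> /circle_invP [xy yx]; exists x. Qed.

Lemma circle_inv_unique x y : circle_units x -> circle x y = 0 -> circle_inv x = y.
Proof.
by move=> /circle_invP [_ yx] xy; rewrite -[LHS]circlex0 -xy circleA yx circle0x.
Qed.

Lemma is_diff_circle {W : normedModType R} (f df g dg : W -> V) (x : W) :
  is_diff x f df -> is_diff x g dg ->
  is_diff x (fun u => circle (f u) (g u))
    (fun v => df v + dg v + (B (f x) (dg v) + B (df v) (g x))).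
Proof.
by move=> fx gx; apply: is_diffD; exact: is_diff_bilinear.
Qed.

Lemma smooth_circle (U : set (V * V)) : open U ->
  smooth_on U (fun p => circle p.1 p.2).
Proof.
move=> oU k; have fstk : Ck_on k U fst.
  by apply: Ck_on_linear => // p; exact: cvg_fst.
have sndk : Ck_on k U snd.
  by apply: Ck_on_linear => // p; exact: cvg_snd.
by apply: Ck_onD; [| apply: Ck_onD | apply: Ck_on_bilinear].
Qed.

(** * Openness of the unit group and smoothness of inversion *)

Section Units.
Context (surj_of_inj :
  forall f : {linear V -> V}, injective f -> forall y, exists x, f x = y).

(** If x + f x = 0 with x nonzero, then |x| = |f x| <= c |x| < |x|. So id + f is injective, and
    [surj_of_inj] takes the place of a Neumann series. *)
Lemma addr_small_surjective (f : {linear V -> V}) (c : R) : c < 1 ->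
  (forall x, `|f x| <= c * `|x|) -> forall y, exists x, x + f x = y.
Proof.
move=> c1 fc; have lin : linear (fun x => x + f x).
  by move=> a u v; rewrite linearP /= scalerDr addrACA.
pose gM := GRing.isLinear.Build _ _ _ _ _ lin.
pose g : {linear V -> V} := HB.pack (fun x => x + f x) gM.
apply: (surj_of_inj g); apply: raddf_inj => x /= /eqP; rewrite addr_eq0 => /eqP xfx.
apply/eqP; apply: contraT; rewrite -normr_gt0 => x0.
suff : `|x| < `|x| by rewrite ltxx.
have {1}-> : `|x| = `|f x| by rewrite {1}xfx normrN.
by rewrite (le_lt_trans (fc x))// gtr_pMl.
Qed.

(** With |B x y| <= k |x| |y|, both B(z, -) and B(-, z) are strict contractions when |z| < 1/k. This
    gives a right and a left inverse separately, which coincide by associativity. *)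
Lemma circle_units_near0 : exists2 e : R, 0 < e & forall z, `|z| < e -> circle_units z.
Proof.
have [k k0 Bk] := bilinear_schwarz B_continuous.
exists k^-1 => [|z ze]; first by rewrite invr_gt0.
have kz : k * `|z| < 1 by rewrite -ltr_pdivlMl// mulr1.
have [y zy] : exists y, circle z y = 0.
  have [|y yP] := @addr_small_surjective (B z) _ kz _ (- z); first exact: Bk.
  by exists y; rewrite /circle -addrA yP subrr.
have [y' yz] : exists y, circle y z = 0.
  have [|y' yP] := @addr_small_surjective (applyr B z) _ kz _ (- z).
    by move=> x; rewrite mulrAC; exact: Bk.
  by exists y'; rewrite /circle addrAC -[_ + _ + z]/(y' + applyr B z y' + z) yP addNr.
exists y; split => //; suff -> : y = y' by [].
by rewrite -[LHS]circle0x -yz -circleA zy circlex0.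
Qed.

Lemma near_circle_translate x y : circle y x = 0 -> forall e : R, 0 < e ->
  \forall x' \near x, `|circle y x'| < e.
Proof.
move=> yx e e0.
have yd : is_diff x (fun x' => circle y x')
    (fun v => 0 + v + (B y v + B 0 x)).
  by apply: (@is_diff_circle _ (cst y) (fun=> 0) id id).
have /differentiable_continuous : differentiable (circle y) x by case: yd.
rewrite /prop_for /continuous_at yx => /cvgr0_norm_lt; exact.
Qed.

(** With y the inverse of x, a point x' near x is the product of x and [circle y x'], and the latter
    is close to 0, hence a unit. *)
Lemma open_circle_units : open circle_units.
Proof.
rewrite openE => x /circle_invP [xy yx].
have [e e0 He] := circle_units_near0.
have Ux : circle_units x by exists (circle_inv x).
rewrite /interior; near=> x'.
rewrite -[x']circle0x -xy -circleA; apply: circle_unitsM => //.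
by apply: He; near: x'; exact: near_circle_translate.
Unshelve. all: by end_near. Qed.

Lemma is_diff_circle_inv0 : is_diff 0 circle_inv -%R.
Proof.
have [e e0 He] := circle_units_near0.
have [k k0 Bk] := bilinear_schwarz B_continuous.
apply: (is_diff_linear_approx _ (-%R : {linear V -> V})) => [|eps eps0].
  exact: opp_continuous.
have inv0 : circle_inv 0 = 0.
  by apply: circle_inv_unique; [exact: circle_units0|exact: circle0x].
near=> h; rewrite addr0 inv0 subr0 /= opprK.
have [hw _] : circle h (circle_inv h) = 0 /\ circle (circle_inv h) h = 0.
  by apply/circle_invP/He; near: h; exact: nbhs0_lt.
set w := circle_inv h in hw *.
(* This is the error of the linear approximation - h of the inverse w; it is shown to be quadratic
   in h. *)
have {hw} hw : w + h = - B h w.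
  by apply/eqP; rewrite -addr_eq0 [w + h]addrC -[eqbLHS]/(circle h w) hw.
(* Half suffices to absorb |B h w| <= |w| / 2 in |w| <= |h| + |B h w|, whence |w| <= 2 |h|. *)
have kh : k * `|h| <= 2^-1.
  rewrite -ler_pdivlMl//; near: h; apply: nbhs0_le.
  by rewrite mulr_gt0 ?invr_gt0.
(* Chosen so that the error, at most k |h| |w| <= 2 k |h|^2, is at most eps |h|. *)
have kh' : `|h| <= (2 * k)^-1 * eps.
  by near: h; apply: nbhs0_le; rewrite mulr_gt0 ?invr_gt0 ?mulr_gt0.
have w2h : `|w| <= 2 * `|h|.
  have : `|w| <= `|h| + 2^-1 * `|w|.
    rewrite -[leLHS](_ : `|- B h w - h| = _); last by rewrite -hw addrK.
    rewrite (le_trans (ler_normB _ _))// normrN addrC lerD2l.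
    by rewrite (le_trans (Bk _ _))// ler_wpM2r.
  by lra.
rewrite hw normrN (le_trans (Bk _ _))// mulrAC ler_wpM2r//.
have : 2 * k * `|h| <= eps by rewrite -ler_pdivlMl// mulr_gt0.
by have := ler_wpM2l (ltW k0) w2h; lra.
Unshelve. all: by end_near. Qed.

(** Formally - (1 + y) v (1 + y), the usual differential - a^-1 v a^-1 of inversion, where 1 + y =
    a^-1. *)
Definition circle_inv_diff y v : V := let w := - v + B y (- v) in w + B w y.

(** With y the inverse of x, the inverse of x' is that of [circle y x'] times y. As [circle y x] is
    0, the chain rule reduces the claim to the differential at 0. *)
Lemma is_diff_circle_inv x : circle_units x ->
  is_diff x circle_inv (circle_inv_diff (circle_inv x)).
Proof.
move=> Ux; have [xy yx] := circle_invP _ Ux; set y := circle_inv x in xy yx *.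
pose f x' := circle (circle_inv (circle y x')) y.
apply: (@near_eq_is_diff _ _ _ f).
  have nU : \forall x' \near x, circle_units x'.
    by apply: open_nbhs_nbhs; split; [exact: open_circle_units|].
  near=> x'; have Ux' : circle_units x' by near: x'.
  have Uyx' : circle_units (circle y x').
    by apply: circle_unitsM => //; exact: circle_inv_unit.
  apply/esym/circle_inv_unique => //.
  have [yi _] := circle_invP _ Uyx'.
  have xyx' : x' = circle x (circle y x') by rewrite circleA xy circle0x.
  by rewrite {1}xyx' /f -circleA (circleA (circle y x')) yi circle0x.
have d1 : is_diff x (circle y) (fun v => v + B y v).
  have := @is_diff_circle _ (cst y) (fun=> 0) id id x (is_diff_cst _ _) (is_diff_id _).
  move=> d; apply: (is_diff_eq d); apply/funext => v /=.
  by rewrite linear0l addr0 add0r.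
have d2 : is_diff (circle y x) circle_inv -%R by rewrite yx; exact: is_diff_circle_inv0.
have d3 := @is_diff_comp _ _ _ _ _ _ _ _ _ d1 d2.
have := @is_diff_circle _ _ _ (cst y) (fun=> 0) x d3 (is_diff_cst _ _).
move=> d; apply: (is_diff_eq d); apply/funext => v /=.
by rewrite linear0r addr0 add0r /circle_inv_diff linearN opprD.
Unshelve. all: by end_near. Qed.

(** The differential is polynomial in the inverse itself, so class C^k of the inverse gives class
    C^(k+1). *)
Lemma smooth_circle_inv : smooth_on circle_units circle_inv.
Proof.
elim=> [|k IH].
  by move=> x Ux; apply: differentiable_continuous; case: (is_diff_circle_inv _ Ux).
have oU := open_circle_units.
apply: (Ck_onS _ _ _ (fun x => circle_inv_diff (circle_inv x))) => // v.
  exact: is_diff_circle_inv.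
have wk : Ck_on k circle_units (fun x => - v + B (circle_inv x) (- v)).
  by apply: Ck_onD => //; [|apply: Ck_on_bilinear => //]; exact: Ck_on_cst.
by apply: Ck_onD => //; exact: Ck_on_bilinear.
Qed.

Lemma circle_is_lie_group : is_lie_group circle_units circle 0.
Proof.
have oU := open_circle_units; split => //.
- exact: circle_units0.
- by split=> *; [exact: circle_unitsM|exact: circleA].
- split=> [x _|]; first by rewrite circle0x circlex0.
  apply: smooth_circle.
  rewrite -[X in open X]/((fst @^-1` circle_units) `&` (snd @^-1` circle_units)).
  by apply: openI; apply: open_comp => // p _; [exact: cvg_fst|exact: cvg_snd].
- exists circle_inv; split; first exact: smooth_circle_inv.
  by move=> x Ux; have [xy yx] := circle_invP _ Ux; split => //; exact: circle_inv_unit.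
Qed.

End Units.

End CircleMonoid.

(** * Tangent space at the identity, left-invariant fields and their bracket *)

Section TangentSpace.
Context {R : realType} {V : normedModType R} (B : {bilinear V -> V -> V}).
Context (B_continuous : continuous (fun p : V * V => B p.1 p.2)).

Lemma is_diff_scale {W : normedModType R} (v : W) (t : R) :
  is_diff t (fun s => s *: v) (fun s => s *: v).
Proof. exact: is_diff_scalel. Qed.

(** The witness for v is the line x + t v, restricted to the open set of times at which it lies in
    [G]. *)
Lemma open_tangent_space (G : set V) x : open G -> G x -> tangent_space G x = setT.
Proof.
move=> oG Gx; apply/seteqP; split=> // v _; pose gamma (t : R) := x + t *: v.
have dgamma t : is_diff t gamma (fun s => s *: v).
  have d := @is_diffD _ _ _ (cst x) _ (fun=> 0) _ t (is_diff_cst _ _) (is_diff_scale v t).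
  by apply: (is_diff_eq d); apply/funext => s /=; rewrite add0r.
have gamma_continuous : continuous gamma.
  by move=> t; apply: differentiable_continuous; case: (dgamma t).
have oI : open (gamma @^-1` G).
  by apply: open_comp => // t _; exact: gamma_continuous.
exists gamma, (gamma @^-1` G); split => //.
- by split=> //=; rewrite /gamma scale0r addr0.
- case=> [|k]; first by move=> t _; exact: gamma_continuous.
  apply: (@Ck_onS _ _ _ _ _ gamma (fun (_ s : R) => s *: v) oI) => w.
  exact: Ck_on_cst.
- by rewrite /gamma scale0r addr0.
- by apply: is_derive_eq (is_diff_is_derive _ _ _ (dgamma 0)) _; rewrite scale1r.
Qed.

Lemma circle_left_invariant_field X :
  left_invariant_field (circle B) 0 X = (fun h => X + B h X).
Proof.
apply/funext => h; rewrite /left_invariant_field.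
have d := @is_diff_circle _ _ B B_continuous _ (cst h) (fun=> 0) id id 0
  (is_diff_cst _ _) (is_diff_id _).
by rewrite (@diff_val _ _ _ _ _ _ _ d) /= linear0l addr0 add0r.
Qed.

(** The field of Z is affine with linear part v |-> B(v, Z) and value Z at 0, so DY.X - DX.Y at 0 is
    B(X, Y) - B(Y, X). *)
Lemma circle_lie_group_bracket X Y :
  lie_group_bracket (circle B) 0 X Y = B X Y - B Y X.
Proof.
rewrite /lie_group_bracket /vector_field_bracket !circle_left_invariant_field.
have d Z : is_diff 0 (fun h => Z + B h Z) (fun v => B v Z).
  have d1 := is_diff_bilinear B _ _ _ _ 0 B_continuous (is_diff_id _) (is_diff_cst Z _).
  have d2 := @is_diffD _ _ _ (cst Z) _ (fun=> 0) _ 0 (is_diff_cst _ _) d1.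
  by apply: (is_diff_eq d2); apply/funext => v; rewrite !fctE linear0l !add0r.
rewrite (@diff_val _ _ _ _ _ _ _ (d X)) (@diff_val _ _ _ _ _ _ _ (d Y)).
by rewrite !linear0l !addr0.
Qed.

End TangentSpace.

(** * Reduction to scalar analysis through finitely many continuous coordinates *)

Section Coordinates.
Context {R : realType} {V : normedModType R} {I : finType}.
Context (e : I -> V) (phi : I -> {linear V -> R}).
Context (phi_continuous : forall i, continuous (phi i)).
Context (phiK : forall x, x = \sum_i phi i x *: e i).

Lemma is_diff_sum_scale {W : normedModType R} (f df : I -> W -> R) x :
  (forall i, is_diff x (f i) (df i)) ->
  is_diff x (fun y => \sum_i f i y *: e i) (fun v => \sum_i df i v *: e i).
Proof.
move=> fd; elim: (index_enum I) => [|i s IH].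
  under eq_fun do rewrite big_nil; under [X in is_diff _ _ X]eq_fun do rewrite big_nil.
  exact: is_diff_cst.
under eq_fun do rewrite big_cons.
under [X in is_diff _ _ X]eq_fun do rewrite big_cons.
apply: is_diffD => //.
exact: (@is_diff_comp _ _ _ _ (f i) _ _ _ _ (fd i) (is_diff_scale _ _)).
Qed.

(** Each coordinate is a real function with zero derivative, hence constant. *)
Lemma is_diff0_cst (f : R -> V) : (forall t, is_diff t f (fun=> 0)) ->
  forall s t, f s = f t.
Proof.
move=> fd s t; rewrite [f s]phiK [f t]phiK; apply: eq_bigr => i _; congr (_ *: _).
apply: (@is_derive_0_is_cst _ (fun u => phi i (f u))) => u.
have dphi : is_diff (f u) (phi i) (phi i).
  by apply: DiffDef; [exact: linear_differentiable|rewrite diff_lin].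
have d := @is_diff_comp _ _ _ _ f _ _ _ _ (fd u) dphi.
by apply: is_derive_eq (is_diff_is_derive _ _ _ d) _; rewrite /= linear0.
Qed.

Lemma bilinear_continuous (B : {bilinear V -> V -> V}) :
  continuous (fun p : V * V => B p.1 p.2).
Proof.
move=> p.
rewrite (_ : (fun p : V * V => B p.1 p.2) = fun p : V * V =>
    \sum_i phi i p.1 *: \sum_j phi j p.2 *: B (e i) (e j)); last first.
  apply/funext => q; rewrite {1}[q.1]phiK linear_sumlz; apply: eq_bigr => i _.
  rewrite linearZl_LR /= {1}[q.2]phiK linear_sumr; congr (_ *: _).
  by apply: eq_bigr => j _; rewrite linearZr_LR.
have phiF i : {for p, continuous (fun q : V * V => phi i q.1)}.
  by apply: (@continuous_comp _ _ _ fst (phi i)); [exact: cvg_fst|exact: phi_continuous].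
have phiS i : {for p, continuous (fun q : V * V => phi i q.2)}.
  by apply: (@continuous_comp _ _ _ snd (phi i)); [exact: cvg_snd|exact: phi_continuous].
apply: cvg_big => [|i _]; first exact: add_continuous.
apply: cvgZ => //; first exact: phiF.
apply: cvg_big => [|j _]; first exact: add_continuous.
by apply: cvgZr_tmp; exact: phiS.
Qed.

(** * Vector-valued exponential generating series *)

Section ExponentialSeries.
Implicit Types (T : nat -> V) (t : R).

Definition geometric_growth T := exists C r : R, 0 <= r /\ forall n, `|T n| <= C * r ^+ n.

Let coef T i : nat -> R := fun n => n`!%:R^-1 * phi i (T n).

(** The sum of t^n T(n) / n!, assembled coordinatewise so that the scalar theory of power series
    provides convergence and termwise differentiation. *)
Definition expser T t : V := \sum_i limn (pseries (coef T i) t) *: e i.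

Lemma geometric_growthS T : geometric_growth T -> geometric_growth (T \o S).
Proof.
move=> [C [r [r0 TC]]]; exists (C * r), r; split => // n /=.
by rewrite -mulrA -exprS.
Qed.

(** Absolute convergence, by comparison with k C times the exponential series at r |t|, where k is a
    Lipschitz constant of [phi i]. *)
Let is_cvg_coef T i t : geometric_growth T -> cvgn (pseries (coef T i) t).
Proof.
move=> [C [r [r0 TC]]]; have [k k0 phik] := linear_lipschitz (phi_continuous i).
have C0 : 0 <= C by have := TC 0%N; rewrite expr0 mulr1; exact: le_trans.
apply: normed_cvg.
apply: (@series_le_cvg _ _ (fun n => k * C * exp_coeff (r * `|t|) n)) => [n|n|n|].
- by rewrite normr_ge0.
- apply: mulr_ge0; first by rewrite mulr_ge0// ltW.
  by apply: exp_coeff_ge0; rewrite mulr_ge0.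
- rewrite /exp_coeff /= !normrM normfV normr_nat normrX exprMn.
  rewrite [leRHS](_ : _ = n`!%:R^-1 * (k * (C * r ^+ n)) * `|t| ^+ n); last by ring.
  rewrite ler_wpM2r ?exprn_ge0// ler_wpM2l ?invr_ge0//.
  by rewrite (le_trans (phik _))// ler_wpM2l// ltW.
- by apply: is_cvg_seriesZ; exact: is_cvg_series_exp_coeff.
Qed.

Let pseries_diffs_coef T i : pseries_diffs (coef T i) = coef (T \o S) i.
Proof.
apply/funext => n; rewrite /pseries_diffs /coef /= factS natrM invfM !mulrA.
by rewrite mulfV ?mul1r// pnatr_eq0.
Qed.

Lemma expser_cvg T t : geometric_growth T ->
  (\sum_(0 <= k < n) (t ^+ k / k`!%:R) *: T k) @[n --> \oo] --> expser T t.
Proof.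
move=> Tg; rewrite (_ : (fun n => _) =
    fun n => \sum_i pseries (coef T i) t n *: e i); last first.
  apply/funext => n; rewrite [LHS]phiK; apply: eq_bigr => i _; congr (_ *: _).
  rewrite raddf_sum /pseries /series /=; apply: eq_bigr => k _.
  by rewrite linearZ /= /coef [RHS]mulrC mulrA.
apply: cvg_big => [|i _]; first exact: add_continuous.
by apply: cvgZr_tmp; exact: is_cvg_coef.
Qed.

(** The factorials turn termwise differentiation into a shift of [T]. *)
Lemma is_diff_expser T t : geometric_growth T ->
  is_diff t (expser T) (fun s => s *: expser (T \o S) t).
Proof.
move=> Tg; have Tg1 := geometric_growthS _ Tg.
have Tg2 := geometric_growthS _ Tg1.
have d i : is_diff t (fun u => limn (pseries (coef T i) u))
    (fun s => s *: limn (pseries (coef (T \o S) i) t)).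
  apply: is_derive_is_diff; rewrite -pseries_diffs_coef.
  (* The series and its first two formal derivatives must converge at a point of absolute value
     larger than |t|; any such point would do. *)
  apply: (@pseries_snd_diffs _ _ (`|t| + 1)); rewrite ?pseries_diffs_coef.
  - exact: is_cvg_coef.
  - exact: is_cvg_coef.
  - exact: is_cvg_coef.
  - by rewrite [ltRHS]ger0_norm ?addr_ge0// ltrDl.
have := is_diff_sum_scale _ _ t d; congr (is_diff_def _ _ _).
by apply/funext => s; rewrite /expser scaler_sumr; apply: eq_bigr => i _; rewrite scalerA.
Qed.

Lemma expser0 T : geometric_growth T -> expser T 0 = T 0%N.
Proof.
move=> /(expser_cvg _ 0) /cvg_lim <- //.
apply: lim_near_cst => //; near=> n.
have n0 : (0 < n)%N by near: n; exists 1%N.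
rewrite big_ltn// big1_seq ?addr0 ?divr1 ?scale1r// => k.
rewrite mem_index_iota => /andP[_ /andP[k0 _]].
by rewrite expr0n gtn_eqF// mul0r scale0r.
Unshelve. all: by end_near. Qed.

(** Turns a recursion on coefficients into an identity of sums; it yields the differential equations
    of the exponential. *)
Lemma expser_affine (f : {linear V -> V}) (b : V) (T T' : nat -> V) t :
  continuous f -> geometric_growth T -> geometric_growth T' ->
  T' 0%N = b + f (T 0%N) -> (forall n, T' n.+1 = f (T n.+1)) ->
  expser T' t = b + f (expser T t).
Proof.
move=> fc Tg T'g T'0 T'S.
have fT : f (\sum_(0 <= k < n) (t ^+ k / k`!%:R) *: T k) @[n --> \oo] --> f (expser T t).
  by apply: continuous_cvg; [exact: fc|exact: expser_cvg].
(* The empty partial sum is excluded: it lacks the index 0 term, which carries [b]. *)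
have sumE n : (0 < n)%N -> b + f (\sum_(0 <= k < n) (t ^+ k / k`!%:R) *: T k) =
    \sum_(0 <= k < n) (t ^+ k / k`!%:R) *: T' k.
  case: n => // n _; rewrite !big_nat_recl// linearD T'0 expr0 fact0 divr1 !scale1r addrA.
  by congr (_ + _); rewrite linear_sum; apply: eq_bigr => k _; rewrite T'S linearZ.
rewrite -(cvg_lim _ (expser_cvg _ t T'g))//; apply: cvg_lim => //.
apply: cvg_trans (cvgD (cvg_cst b) fT); apply: near_eq_cvg.
by near=> n; apply: sumE; near: n; exists 1%N.
Unshelve. all: by end_near. Qed.

End ExponentialSeries.
End Coordinates.

(** * The exponential curve and uniqueness of one-parameter subgroups *)

Section OneParameterSubgroups.
Context {R : realType} {V : normedModType R} (B : {bilinear V -> V -> V}).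
Context (BA : forall x y z, B x (B y z) = B (B x y) z).
Context {I : finType} (e : I -> V) (phi : I -> {linear V -> R}).
Context (phi_continuous : forall i, continuous (phi i)).
Context (phiK : forall x, x = \sum_i phi i x *: e i).
Implicit Types (X : V) (t : R).

Let B_continuous := bilinear_continuous e phi phi_continuous phiK B.

Definition bilin_pow X n : V := iter n (B X) X.

Lemma bilin_powSr X n : bilin_pow X n.+1 = B (bilin_pow X n) X.
Proof. by elim: n => //= n IH; rewrite -BA -IH. Qed.

(** [bilin_pow X m] is the power of exponent m + 1, so the sequence starts with 0, the identity of
    [circle], and its shift is [bilin_pow X]. *)
Let coef X n : V := if n is m.+1 then bilin_pow X m else 0.

Definition circle_exp X : R -> V := expser e phi (coef X).

Let geometric_growth_coef X : geometric_growth (coef X).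
Proof.
have [k k0 Bk] := bilinear_schwarz B_continuous.
have r1 : 1 <= k * `|X| + 1 by rewrite lerDr mulr_ge0// ltW.
have r0 := le_trans ler01 r1.
(* The ratio k |X| already bounds the powers; adding 1 makes it at least 1, which absorbs the index
   shift in [coef]. *)
exists `|X|, (k * `|X| + 1); split=> // -[|n].
  by rewrite normr0 mulr_ge0 ?exprn_ge0.
suff : `|bilin_pow X n| <= `|X| * (k * `|X| + 1) ^+ n.
  by move=> /le_trans; apply; rewrite ler_wpM2l// exprS ler_peMl// exprn_ge0.
elim: n => [|n IH]; first by rewrite expr0 mulr1.
rewrite (le_trans (Bk _ _))// exprSr mulrA mulrC ler_pM ?mulr_ge0 ?(ltW k0)//.
by rewrite lerDl.
Qed.

Lemma circle_exp_cvg X t :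
  (\sum_(1 <= n < N.+1) (t ^+ n / n`!%:R) *: bilin_pow X n.-1) @[N --> \oo]
    --> circle_exp X t.
Proof.
rewrite (_ : (fun N => _) =
    fun N => \sum_(0 <= n < N.+1) (t ^+ n / n`!%:R) *: coef X n); last first.
  apply/funext => N; rewrite [RHS]big_ltn// scaler0 add0r.
  by apply: eq_big_nat => -[|n].
have := expser_cvg e phi phi_continuous phiK _ t (geometric_growth_coef X).
by rewrite -cvg_shiftS.
Qed.

Lemma circle_exp0 X : circle_exp X 0 = 0.
Proof. exact: (expser0 e phi phi_continuous phiK _ (geometric_growth_coef X)). Qed.

(** The left side is the derivative of [circle_exp X]. Taking for f multiplication by X on the left
    or on the right gives the two differential equations. *)
Lemma expser_bilin_pow (f : {linear V -> V}) X t : continuous f ->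
  (forall n, f (bilin_pow X n) = bilin_pow X n.+1) ->
  expser e phi (bilin_pow X) t = X + f (circle_exp X t).
Proof.
move=> fc fX; have Xg := geometric_growth_coef X.
apply: (expser_affine e phi phi_continuous phiK) => //.
- exact: (geometric_growthS _ Xg).
- by rewrite linear0 addr0.
- by move=> n; rewrite /= fX.
Qed.

Lemma is_diff_circle_expl X t :
  is_diff t (circle_exp X) (fun s => s *: (X + B X (circle_exp X t))).
Proof.
rewrite -(expser_bilin_pow (B X))//.
  exact: (is_diff_expser _ _ _ _ t (geometric_growth_coef X)).
move=> y; apply: (@continuous_comp _ _ _ (fun y => (X, y)) (fun p => B p.1 p.2)).
  by apply: cvg_pair; [exact: cvg_cst|exact: cvg_id].
exact: B_continuous.
Qed.

Lemma is_diff_circle_expr X t :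
  is_diff t (circle_exp X) (fun s => s *: (X + B (circle_exp X t) X)).
Proof.
rewrite -(expser_bilin_pow (applyr B X)).
- exact: (is_diff_expser _ _ _ _ t (geometric_growth_coef X)).
- move=> y; apply: (@continuous_comp _ _ _ (fun y => (y, X)) (fun p => B p.1 p.2)).
    by apply: cvg_pair; [exact: cvg_id|exact: cvg_cst].
  exact: B_continuous.
- by move=> n; rewrite bilin_powSr.
Qed.

(* The product rule makes the derivative of [f t * g (- t)] vanish. *)
Lemma circle_ode_opp_cst (f g : R -> V) X :
  (forall t, is_diff t f (fun s => s *: (X + B (f t) X))) ->
  (forall t, is_diff t g (fun s => s *: (X + B X (g t)))) ->
  forall t, circle B (f t) (g (- t)) = circle B (f 0) (g 0).
Proof.
move=> fd gd t; pose h u := circle B (f u) (g (- u)).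
suff hd u : is_diff u h (fun=> 0).
  by have := is_diff0_cst e phi phi_continuous phiK h hd t 0; rewrite /h oppr0.
move: u => {}t.
have dN : is_diff t (-%R : R -> R) -%R by exact: (is_diffN (f := id)).
have dg : is_diff t (fun s => g (- s)) (fun s => - s *: (X + B X (g (- t)))).
  exact: (@is_diff_comp _ _ _ _ _ _ g _ t dN (gd (- t))).
have d := is_diff_circle B B_continuous _ _ _ _ t (fd t) dg.
apply: (is_diff_eq d); apply/funext => s /=.
rewrite linearZr_LR linearZl_LR /= !scaleNr -scalerBr [- _ + _]addrC -scalerBr -scalerDr.
rewrite linearDl linearDr /= BA [X in _ *: X](_ : _ = 0) ?scaler0//.
set a := B (f t) X; set b := B X _; set c := B a _.
by rewrite [X + a]addrC [a + c]addrC !addrKA addrA subrK subrr.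
Qed.

Lemma circle_expD X s t :
  circle_exp X (s + t) = circle B (circle_exp X s) (circle_exp X t).
Proof.
(* As functions of v, both E(u + v) and E(v) solve the required equations, so the product keeps its
   value at v = 0. The case u = 0 shows that E(- t) is a left inverse of E(t). *)
have expE u v : circle B (circle_exp X (u + v)) (circle_exp X (- v)) = circle_exp X u.
  have expld w : is_diff w (fun v => circle_exp X (u + v))
      (fun s => s *: (X + B (circle_exp X (u + w)) X)).
    have dw : is_diff w (+%R u) id.
      have d := @is_diffD _ _ _ (cst u) id (fun=> 0) id w (is_diff_cst _ _) (is_diff_id _).
      by apply: (is_diff_eq d); apply/funext => v' /=; rewrite add0r.
    exact: (@is_diff_comp _ _ _ _ _ _ (circle_exp X) _ w dw (is_diff_circle_expr X (u + w))).
  have -> := circle_ode_opp_cst _ _ X expld (is_diff_circle_expl X) v.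
  by rewrite circle_exp0 circlex0 addr0.
have := expE 0 (- t); rewrite add0r opprK circle_exp0 => expNt.
by rewrite -(expE s t) -circleA// expNt circlex0.
Qed.

Lemma circle_exp_unit X t : circle_units B (circle_exp X t).
Proof.
by exists (circle_exp X (- t)); rewrite -!circle_expD addrC !addNr circle_exp0.
Qed.

Lemma smooth_circle_exp X : smooth_on setT (circle_exp X).
Proof.
elim=> [|k IH].
  by move=> t _; apply: differentiable_continuous; case: (is_diff_circle_expr X t).
apply: (@Ck_onS _ _ _ _ _ (circle_exp X)
  (fun t s => s *: X + B (circle_exp X t) (s *: X)) openT) => [t _|s].
  apply: (is_diff_eq (is_diff_circle_expr X t)); apply/funext => s.
  by rewrite linearZr_LR scalerDr.
apply: Ck_onD; [exact: openT|exact/Ck_on_cst/openT|].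
by apply: Ck_on_bilinear => //; [exact: openT|exact/Ck_on_cst/openT].
Qed.

Lemma circle_one_parameter_subgroupP X (gamma : R -> V) :
  one_parameter_subgroup (circle_units B) (circle B) X gamma <->
  gamma = circle_exp X.
Proof.
split=> [[_ gammaU gammaD dgamma]|->]; last first.
  split=> [|t|s t|]; [exact: smooth_circle_exp|exact: circle_exp_unit|exact: circle_expD|].
  apply: is_derive_eq (is_diff_is_derive _ _ _ (is_diff_circle_expr X 0)) _.
  by rewrite circle_exp0 linear0l addr0 scale1r.
(* [gamma 0] is an idempotent unit, hence the identity. *)
have gamma0 : gamma 0 = 0.
  have [y [_ yg]] := gammaU 0.
  have := gammaD 0 0; rewrite addr0 => /(congr1 (circle B y)).
  by rewrite circleA// yg circle0x.
(* The subgroup law writes gamma(u) as gamma(t) times gamma(u - t); differentiating at u = t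
   involves only the initial velocity X. *)
have gammad t : is_diff t gamma (fun s => s *: (X + B (gamma t) X)).
  have -> : gamma = fun u => circle B (gamma t) (gamma (u - t)).
    by apply/funext => u; rewrite -gammaD addrC subrK.
  have dsub : is_diff t (fun u => u - t) id.
    have d := @is_diffD _ _ _ id (cst (- t)) id (fun=> 0) t (is_diff_id _) (is_diff_cst _ _).
    by apply: (is_diff_eq d); apply/funext => v' /=; rewrite addr0.
  have d0 : is_diff (t - t) gamma (fun s => s *: X).
    by rewrite subrr; exact: is_derive_is_diff.
  have dg := @is_diff_comp _ _ _ _ _ _ gamma _ t dsub d0.
  have d := is_diff_circle B B_continuous _ _ _ _ t (is_diff_cst (gamma t) t) dg.
  apply: (is_diff_eq d); apply/funext => s /=.
  by rewrite subrr gamma0 circlex0 linear0l addr0 add0r linearZr_LR scalerDr.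
(* Hence gamma(t) times E(- t) is the identity; multiplying by E(t) on the right gives gamma(t) =
   E(t). *)
apply/funext => t; have := circle_ode_opp_cst _ _ _ gammad (is_diff_circle_expl X) t.
rewrite gamma0 circle_exp0 circlex0 => ge.
rewrite -[LHS](circlex0 B) -(circle_exp0 X) -(addNr t) circle_expD circleA//.
by rewrite ge circle0x.
Qed.

Lemma circle_lie_exp X : lie_exp (circle_units B) (circle B) X = circle_exp X 1.
Proof.
rewrite /lie_exp; have /circle_one_parameter_subgroupP -> // :=
  @getPex _ (one_parameter_subgroup (circle_units B) (circle B) X)
    (ex_intro _ _ (proj2 (circle_one_parameter_subgroupP X _) erefl)).
Qed.

End OneParameterSubgroups.

(** * Matrix entries as coordinates on the space of linear maps *)

Section HomSpace.
Import VectorInternalTheory.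
Context {R : realType} {aT rT : vectType R}.

Definition hom_entry (ij : 'I_(dim aT) * 'I_(dim rT)) (f : 'Hom(aT, rT)) : R :=
  f2mx f ij.1 ij.2.

Definition hom_delta (ij : 'I_(dim aT) * 'I_(dim rT)) : 'Hom(aT, rT) :=
  Hom (delta_mx ij.1 ij.2).

Let HomP (a : R) (A A' : 'M[R]_(dim aT, dim rT)) :
  Hom (a *: A + A') = a *: (Hom A : 'Hom(aT, rT)) + Hom A'.
Proof.
apply/lfunP => v; rewrite add_lfunE scale_lfunE unlock /=.
by rewrite mulmxDr -scalemxAr linearP.
Qed.

Let f2mxP (a : R) (f h : 'Hom(aT, rT)) : f2mx (a *: f + h) = a *: f2mx f + f2mx h.
Proof. by case: f h => A [A']; rewrite -HomP. Qed.

Lemma hom_entry_is_linear ij : linear (hom_entry ij).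
Proof. by move=> a f h; rewrite /hom_entry f2mxP !mxE. Qed.
HB.instance Definition _ ij :=
  GRing.isLinear.Build R 'Hom(aT, rT) R _ (hom_entry ij) (hom_entry_is_linear ij).

(** The max norm dominates every entry. *)
Lemma hom_entry_continuous ij : continuous (hom_entry ij).
Proof.
apply: linear_contraction_continuous => f; rewrite [leRHS]mx_normrE.
exact: (le_bigmax_cond _ (fun kl => `|f2mx f kl.1 kl.2|)).
Qed.

Lemma hom_sum_delta f : f = \sum_ij hom_entry ij f *: hom_delta ij.
Proof.
have Hom0 : Hom 0 = 0 :> 'Hom(aT, rT).
  by apply/lfunP => v; rewrite zero_lfunE unlock /= mulmx0 linear0.
have HomZ (a : R) A : Hom (a *: A) = a *: Hom A :> 'Hom(aT, rT).
  by have := HomP a A 0; rewrite Hom0 !addr0.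
have HomD : {morph (fun A => Hom A : 'Hom(aT, rT)) : A A' / A + A'}.
  by move=> A A'; have := HomP 1 A A'; rewrite !scale1r.
case: f => A; rewrite [A in LHS]matrix_sum_delta pair_big /=.
by rewrite (big_morph _ HomD Hom0); apply: eq_bigr => ij _; exact: HomZ.
Qed.

End HomSpace.

Lemma injective_endo_surjective {K : fieldType} {U : vectType K}
    (f : {linear U -> U}) : injective f -> forall y, exists x, f x = y.
Proof.
move=> f_inj y; pose h : 'End(U) := linfun f.
have h0 : lker h == 0%VS by apply/lker0P => u v; rewrite !lfunE; exact: f_inj.
have : y \in limg h.
  suff /eqP -> : limg h == fullv by exact: memvf.
  by rewrite eqEdim subvf /= limg_dim_eq// (eqP h0) capv0.
by move=> /memv_imgP [x _ ->]; exists x; rewrite lfunE.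
Qed.

(** * The bilinear map s d t of a Lie 2-algebra and the final assembly *)

Section DegreeMinusOne.
Context {R : realType} (g : lie2_algebra R).

Lemma comp_d_is_bilinear :
  bilinear_for (GRing.Scale.Law.clone _ _ *:%R _) (GRing.Scale.Law.clone _ _ *:%R _)
    (@comp_d R g).
Proof.
by split=> [u|u] a x y; rewrite /comp_d ?comp_lfunDl ?comp_lfunDr
  -?comp_lfunZl -?comp_lfunZr ?comp_lfunDr -?comp_lfunZr.
Qed.
HB.instance Definition _ := bilinear_isBilinear.Build R (hom_m1 g) (hom_m1 g) (hom_m1 g)
  _ _ (@comp_d R g) comp_d_is_bilinear.

Lemma comp_dA (x y z : hom_m1 g) : comp_d x (comp_d y z) = comp_d (comp_d x y) z.
Proof. by rewrite /comp_d !comp_lfunA. Qed.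

Lemma comp_d_continuous : continuous (fun p : hom_m1 g * hom_m1 g => comp_d p.1 p.2).
Proof. exact: (bilinear_continuous _ hom_entry hom_entry_continuous hom_sum_delta). Qed.

End DegreeMinusOne.

Theorem lemma5p5 (R : realType) (g : lie2_algebra R) :
  [/\ is_lie_group (Aut_m1 g) (star g) 0,
      is_lie_algebra_of (Aut_m1 g) (star g) 0
        (Der_m1 g) (Der_m1_bracket g) &
      forall Theta : hom_m1 g, Der_m1 g Theta ->
        (exists! gamma : R -> hom_m1 g,
           one_parameter_subgroup (Aut_m1 g) (star g) Theta gamma) /\
        (\sum_(1 <= n < N.+1) n`!%:R^-1 *: comp_d_pow Theta n.-1) @[N --> \oo]
          --> lie_exp (Aut_m1 g) (star g) Theta].
Proof.
have Bc := @comp_d_continuous R g.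
have BA := @comp_dA R g.
have surj := @injective_endo_surjective R (hom_m1 g).
(* [star g] and [Aut_m1 g] are convertible to [circle] and [circle_units] of [comp_d], so the
   general results apply as they stand. *)
have lie := circle_is_lie_group _ Bc BA surj.
split; first exact: lie.
- split; last by move=> X Y _ _; exact: circle_lie_group_bracket.
  by case: lie => oU U0 _ _ _; exact: open_tangent_space.
- move=> Theta _.
  have subgroupP := circle_one_parameter_subgroupP _ BA _ _
    (@hom_entry_continuous R _ _) (@hom_sum_delta R _ _) Theta.
  split.
    eexists; split; first exact: (proj2 (subgroupP _) erefl).
    by move=> gamma /subgroupP ->.
  have -> := circle_lie_exp _ BA _ _
    (@hom_entry_continuous R _ _) (@hom_sum_delta R _ _) Theta.
  have := circle_exp_cvg (@comp_d R g) _ _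
    (@hom_entry_continuous R _ _) (@hom_sum_delta R _ _) Theta 1.
  (* [bilin_pow] of [comp_d] is convertible to [comp_d_pow]; only the factors 1^n remain to be
     removed. *)
  rewrite (_ : (fun N => _) =
      fun N => \sum_(1 <= n < N.+1) n`!%:R^-1 *: comp_d_pow Theta n.-1) //.
  apply/funext => N; apply: eq_bigr => n _; congr (_ *: _).
  by rewrite expr1n mul1r.
Qed.
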